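(* Let $n \ge 2$ and $2 \le t \le n$. In the $n$-player collaboration chain, the expected time $e_{t,t-1}$ from the first arrival in Stage $t$ to the first arrival in Stage $t-1$ is $$e_{t,t-1} = \frac{n(n-1)}{t(t-1)} = \frac{\binom{n}{2}}{\binom{t}{2}} .$$
   Context: The chain: there are $n$ players, each initially on a different team (so $n$ teams of size 1). At each time step an ordered pair (winner, loser) of distinct players is chosen uniformly at random among the $n(n-1)$ such pairs, independently of the past; the loser leaves his or her team and joins the winner's team (nothing changes if they are already on the same team). The state of the system is the partition of $n$ given by the multiset of sizes of the nonempty teams. The system is in Stage $t$ when exactly $t$ nonempty teams remain; the chain starts in Stage $n$, and the number of teams never increases and decreases by at most 1 in each step. Time is measured in number of time steps. $e_{t,t-1}$ is the expected number of time steps from the first time the chain (started from the initial state with $n$ teams of size 1) is in Stage $t$ to the first time it is in Stage $t-1$. *)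

(* Defs.v *)
From mathcomp Require Import all_boot all_order all_algebra.
From mathcomp Require Import all_classical all_reals all_analysis.
Set Implicit Arguments.
Unset Strict Implicit.
Unset Printing Implicit Defensive.
Import Order.TTheory GRing.Theory Num.Theory.

Local Open Scope classical_set_scope.
Local Open Scope ring_scope.

Definition match_of (n : nat) : finType := {g : 'I_n * 'I_n | g.1 != g.2}.

Definition winner (n : nat) (g : match_of n) : 'I_n := (val g).1.
Definition loser (n : nat) (g : match_of n) : 'I_n := (val g).2.

(* An assignment sends each player to the label of his or her team; the label
   of a team is the player who is initially alone in it. *)
Definition assignment (n : nat) : Type := {ffun 'I_n -> 'I_n}.

Definition singletons (n : nat) : assignment n := [ffun i => i].

Definition play (n : nat) (f : assignment n) (g : match_of n) : assignment n :=
  [ffun i => if i == loser g then f (winner g) else f i].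

(* teams game k is the assignment after k time steps; game k is the match
   played during step k + 1. *)
Fixpoint teams (n : nat) (game : nat -> match_of n) (k : nat) : assignment n :=
  if k is k'.+1 then play (teams game k') (game k') else singletons n.

(* The partition of n given by the sizes of the nonempty teams, as a
   nonincreasing list of positive parts. *)
Definition team_sizes (n : nat) (f : assignment n) : seq nat :=
  sort geq [seq s <- [seq #|[set i | f i == c]%SET| | c <- enum 'I_n] | (0 < s)%N].

Definition state (n : nat) (game : nat -> match_of n) (k : nat) : seq nat :=
  team_sizes (teams game k).

Definition stage (n : nat) (game : nat -> match_of n) (k : nat) : nat :=
  size (state game k).

(* Equal to +oo when stage t is never reached (infimum of the empty set). *)
Definition first_arrival (R : realType) (n : nat) (game : nat -> match_of n)
    (t : nat) : \bar R :=
  ereal_inf [set (k%:R)%:E | k in [set k : nat | stage game k = t]].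

(* Measurability for the discrete sigma-algebra on matches. It is spelled out
   because measurableType requires a pointed type, and match_of n is empty for
   n < 2. *)
Definition measurable_match (d : measure_display) (T : measurableType d)
    (n : nat) (X : T -> match_of n) : Prop :=
  forall A : set (match_of n), measurable (X @^-1` A).

Definition uniform_match (d : measure_display) (T : measurableType d)
    (R : realType) (P : probability T R) (n : nat) (X : T -> match_of n) : Prop :=
  forall g : match_of n, P (X @^-1` [set g]) = (#|match_of n|%:R^-1)%:E.

(* Mutual independence: the product rule over every finite subfamily. *)
Definition independent_matches (d : measure_display) (T : measurableType d)
    (R : realType) (P : probability T R) (n : nat)
    (X : nat -> T -> match_of n) : Prop :=
  forall (J : seq nat) (A : nat -> set (match_of n)), uniq J ->
    P (\bigcap_(k in [set` J]) (X k @^-1` A k)) =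
    (\prod_(k <- J) P (X k @^-1` A k))%E.

Definition expected_passage (d : measure_display) (T : measurableType d)
    (R : realType) (P : probability T R) (n : nat)
    (X : nat -> T -> match_of n) (s t : nat) : \bar R :=
  (\int[P]_w (first_arrival R (fun k => X k w) t
              - first_arrival R (fun k => X k w) s))%E.

(* Main.v *)
Require Import Defs.
From mathcomp Require Import all_boot all_order all_algebra.
From mathcomp Require Import all_classical all_reals all_analysis.
From mathcomp Require Import measurable_realfun zify ring.
Import Order.TTheory GRing.Theory Num.Theory.
Local Open Scope ring_scope.

(** Time reversal. Let [copy g] send the loser of [g] to the winner and fix all
    other players. After matches [g_0, ..., g_(k-1)] the assignment is the
    composition [copy g_0 \o ... \o copy g_(k-1)], so the number of teams is the
    size of its image. Building the image by adding matches on the left instead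
    of on the right does not change its law at a fixed time, but turns its size
    into a pure death chain (the coalescent): a set of [a] ancestors loses one
    element exactly when winner and loser both belong to it, that is, for
    [a (a - 1)] of the [N = n (n - 1)] matches. The first arrival in Stage [s]
    is the sum over [k] of the indicators of [s < stage k], so its expectation
    only involves the laws at fixed times, and it equals the hitting time of
    [s] by the coalescent, [\sum_(s < j <= n) N / (j (j - 1)) = N (1/s - 1/n)].
    Subtracting these finite expectations for [s = t - 1] and [s = t] gives
    the theorem. *)

(** * Stages as sizes of ancestor sets *)

Definition copy {n : nat} (g : match_of n) (i : 'I_n) : 'I_n :=
  if i == loser g then winner g else i.

(** The head of [u], the earliest match, is applied last: consing a match is one step of the
    reversed chain. *)
Definition ancestors {n : nat} (u : seq (match_of n)) : {set 'I_n} :=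
  foldr (fun g (A : {set 'I_n}) => [set copy g i | i in A]%SET) [set: 'I_n]%SET u.

Lemma team_sizesE (n : nat) (f : assignment n) :
  size (team_sizes f) = #|[set f i | i in [set: 'I_n]]%SET|.
Proof.
rewrite /team_sizes size_sort size_filter count_map cardE -size_filter.
congr size; rewrite enumT; apply: eq_filter => c /=; rewrite card_gt0.
apply/set0Pn/imsetP => [[i]|[i _ ->]].
  by rewrite inE => /eqP fi; exists i; rewrite ?inE.
by exists i; rewrite inE.
Qed.

(** Because [play f g] is [f \o copy g]: matches compose on the right. *)
Lemma imset_play (n : nat) (f : assignment n) (g : match_of n) (A : {set 'I_n}) :
  [set play f g i | i in A]%SET = [set f i | i in [set copy g i | i in A]]%SET.
Proof.
rewrite -imset_comp; apply: eq_imset => i /=.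
by rewrite ffunE /copy; case: ifP.
Qed.

Lemma teams_foldl (n : nat) (game : nat -> match_of n) (k : nat) :
  teams game k = foldl (@play n) (Defs.singletons n) (mkseq game k).
Proof. by elim: k => [|k IHk] //; rewrite mkseqS foldl_rcons -IHk. Qed.

Lemma imset_foldl_play (n : nat) (f : assignment n) (u : seq (match_of n)) :
  [set foldl (@play n) f u i | i in [set: 'I_n]]%SET = [set f i | i in ancestors u]%SET.
Proof. by elim: u f => //= g u IHu f; rewrite IHu imset_play. Qed.

Lemma stage_ancestors (n : nat) (game : nat -> match_of n) (k : nat) :
  stage game k = #|ancestors (mkseq game k)|.
Proof.
rewrite /stage /state team_sizesE teams_foldl imset_foldl_play card_imset //.
by move=> i j; rewrite !ffunE.
Qed.

(** * One step of the coalescent *)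

Lemma winner_neq_loser (n : nat) (g : match_of n) : winner g != loser g.
Proof. exact: (valP g). Qed.

(** If the loser is in [A], the winner replaces it, so an element is lost only if the winner was
    there already; otherwise [copy g] fixes [A] pointwise. *)
Lemma card_copy (n : nat) (g : match_of n) (A : {set 'I_n}) :
  #|[set copy g i | i in A]%SET| =
  (#|A| - ((winner g \in A) && (loser g \in A)))%N.
Proof.
have [lA|lA] := boolP (loser g \in A); last first.
  rewrite andbF subn0; congr #|pred_of_set _|.
  rewrite -[RHS]imset_id; apply: eq_in_imset => i iA.
  by rewrite /copy; case: eqP => // il; rewrite -il iA in lA.
have -> : [set copy g i | i in A]%SET = (winner g |: A :\ loser g)%SET.
  apply/setP => j; rewrite !inE; apply/imsetP/idP => [[i iA ->]|].
    by rewrite /copy; case: (eqVneq i) => [_|->]; rewrite ?eqxx ?iA ?orbT.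
  case/orP => [/eqP ->|/andP[jl jA]]; last by exists j; rewrite // /copy (negbTE jl).
  by exists (loser g); rewrite // /copy eqxx.
rewrite cardsU1 !inE winner_neq_loser /= andbT (cardsD1 (loser g) A) lA.
by case: (winner g \in A); rewrite ?subn0 ?addKn.
Qed.

Lemma card_inner_matches (n : nat) (A : {set 'I_n}) :
  #|[set g : match_of n | (winner g \in A) && (loser g \in A)]%SET| =
  (#|A| * #|A|.-1)%N.
Proof.
rewrite -(card_imset _ val_inj).
have -> : [set val g | g in [set g : match_of n |
    (winner g \in A) && (loser g \in A)]]%SET =
  (finset.setX A A :\: [set (i, i) | i in A])%SET.
  apply/setP => -[i j]; rewrite !inE /=; apply/imsetP/idP.
    case=> -[[a b] /= ab]; rewrite inE /winner /loser /= => gA [-> ->].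
    rewrite gA andbT; apply/imsetP => -[l _ [al bl]].
    by rewrite al bl eqxx in ab.
  case/andP=> ijA /andP[iA jA].
  have ij : i != j.
    by apply: contra ijA => /eqP <-; apply: imset_f.
  by exists (exist (fun g : 'I_n * 'I_n => g.1 != g.2) (i, j) ij); rewrite ?inE /winner /loser /= ?iA.
rewrite cardsD (finset.setIidPr _); last first.
  by apply/fintype.subsetP => _ /imsetP[i iA ->]; rewrite inE /= iA.
rewrite cardsX card_imset; last by move=> i j [].
by rewrite -[X in (_ - X)%N = _]muln1 -mulnBr subn1.
Qed.

Lemma card_match (n : nat) : #|match_of n| = (n * n.-1)%N.
Proof.
have := card_inner_matches _ [set: 'I_n]%SET; rewrite cardsT card_ord => <-.
by rewrite -cardsT; congr #|pred_of_set _|; apply/setP => g; rewrite !inE.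
Qed.

(** Summing over the head innermost, with the later matches [u] fixed, is what makes the reversed
    chain advance by one step. *)
Lemma sum_tupleS (R : nmodType) (M : finType) (k : nat) (F : seq M -> R) :
  \sum_(u : k.+1.-tuple M) F u = \sum_(u : k.-tuple M) \sum_(g : M) F (g :: u).
Proof.
rewrite exchange_big pair_big /=.
rewrite (reindex (fun p : M * k.-tuple M => cons_tuple p.1 p.2)) //=.
exists (fun u => (thead u, [tuple of behead u])) => [[g u] _|u _] /=.
  by congr pair; apply: val_inj.
by rewrite [RHS]tuple_eta; apply: val_inj.
Qed.

Lemma sum_copy (R : pzRingType) (n : nat) (h : nat -> R) (A : {set 'I_n}) :
  \sum_(g : match_of n) h #|[set copy g i | i in A]%SET| =
  h #|A| *+ #|match_of n| + (h #|A|.-1 - h #|A|) *+ (#|A| * #|A|.-1).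
Proof.
rewrite -card_inner_matches -!sumr_const [X in _ + X]big_mkcond -big_split /=.
apply: eq_bigr => g _; rewrite card_copy inE.
by case: ifP => _; rewrite ?subn1 ?subn0 ?addr0 // addrC subrK.
Qed.

(** * Expected hitting times of the coalescent *)

Section Hitting.
Variables (R : realType) (n s : nat).
Hypotheses (n2 : (2 <= n)%N) (s0 : (0 < s)%N).

Let N : R := #|match_of n|%:R.

Let N0 : 0 < N.
Proof. by rewrite ltr0n card_match; nia. Qed.

(* [\sum_(s < j <= a) N / (j (j - 1))], telescoped. *)
Definition hitting (a : nat) : R := N * (s%:R^-1 - (maxn a s)%:R^-1).

(* The probability that [s < stage k], as a normalized count. *)
Definition above (k : nat) : R :=
  (\sum_(u : k.-tuple (match_of n)) (s < #|ancestors u|)%N%:R) / N ^+ k.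

(* The expected remaining time of the coalescent after [k] steps. *)
Definition residual (k : nat) : R :=
  (\sum_(u : k.-tuple (match_of n)) hitting #|ancestors u|) / N ^+ k.

(** After division by [N]: one step lowers the expected remaining time by exactly 1 while [s < a].
    For [a <= s] both values are 0. *)
Lemma hitting_step (a : nat) :
  (hitting a.-1 - hitting a) *+ (a * a.-1) = - (s < a)%N%:R * N.
Proof.
rewrite -[LHS]mulr_natr /hitting; case: ltnP => sa; last first.
  have -> : maxn a.-1 s = s by lia.
  by rewrite subrr mul0r oppr0 mul0r.
case: a sa => // a; rewrite ltnS /= => sa.
rewrite (maxn_idPl _) // natrM.
have a0 : a%:R != 0 :> R by rewrite pnatr_eq0; lia.
by field; rewrite a0 nat1r !pnatr_eq0 /= -lt0n s0.
Qed.

Lemma residualS (k : nat) : residual k.+1 = residual k - above k.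
Proof.
rewrite /residual (sum_tupleS _ _ _ (fun u => hitting #|ancestors u|)) /=.
under eq_bigr do rewrite sum_copy hitting_step -[X in X + _]mulr_natr -mulrDl.
rewrite -mulr_suml big_split /= sumrN exprS /above -/N.
by field; rewrite expf_neq0 ?gt_eqF.
Qed.

(** The function vanishes for [a <= s]; above [s] the crude bound [1/s <= 1] suffices. *)
Lemma hitting_bounds (a : nat) : 0 <= hitting a <= N * (s < a)%N%:R.
Proof.
have sR : 0 < s%:R :> R by rewrite ltr0n.
have aR : 0 < (maxn a s)%:R :> R by rewrite ltr0n; lia.
rewrite pmulr_rge0 // ler_pM2l // subr_ge0 lef_pV2 ?posrE // ler_nat leq_maxr /=.
case: ltnP => sa; last by rewrite subrr.
rewrite lerBlDr (@le_trans _ _ 1) // ?invf_le1 ?ler1n //.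
by rewrite lerDl invr_ge0 ler0n.
Qed.

Lemma residual_bounds (k : nat) : 0 <= residual k <= N * above k.
Proof.
have Nk : 0 <= (N ^+ k)^-1 by rewrite invr_ge0 exprn_ge0 // ltW.
rewrite /residual /above mulrA mulr_sumr; apply/andP; split.
  by rewrite mulr_ge0 // sumr_ge0 // => u _; case/andP: (hitting_bounds #|ancestors u|).
rewrite ler_wpM2r // ler_sum // => u _.
by case/andP: (hitting_bounds #|ancestors u|).
Qed.

Lemma residual0 : residual 0 = hitting n.
Proof.
rewrite /residual expr0 divr1 (eq_bigr (fun=> hitting n)); last first.
  by move=> u _; rewrite tuple0 /= cardsT card_ord.
by rewrite sumr_const card_tuple expn0.
Qed.

Lemma series_above (k : nat) : \sum_(0 <= i < k) above i = hitting n - residual k.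
Proof.
elim: k => [|k IHk]; first by rewrite big_geq // residual0 subrr.
by rewrite big_nat_recr //= IHk residualS; ring.
Qed.

Lemma above_ge0 (k : nat) : 0 <= above k.
Proof. by rewrite divr_ge0 ?sumr_ge0 ?exprn_ge0 // ltW. Qed.

Import numFieldNormedType.Exports.
Local Open Scope classical_set_scope.

(* The partial sums are bounded, so [above] tends to 0; since
   [residual <= N * above], so does [residual]. *)
Lemma cvg_series_above : series above @ \oo --> hitting n.
Proof.
have cvgS : cvgn (series above).
  apply: nondecreasing_is_cvgn.
    by apply/nondecreasing_seqP => k; rewrite /series /= big_nat_recr //= lerDl above_ge0.
  exists (hitting n) => _ [k _ <-]; rewrite /series /= series_above.
  by rewrite gerBl; case/andP: (residual_bounds k).
have above0 := cvg_series_cvg_0 cvgS.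
have residual_cvg : residual @ \oo --> 0.
  apply: (@squeeze_cvgr _ _ _ _ (fun=> 0) (fun k => N * above k)).
  - by near=> k; exact: residual_bounds.
  - exact: cvg_cst.
  - by rewrite -(mulr0 N); apply: cvgMr.
have -> : series above = (fun k => hitting n - residual k).
  by apply/funext => k; rewrite /series /= series_above.
rewrite -[X in _ --> X]subr0; apply: cvgB => //; exact: cvg_cst.
Unshelve. all: by end_near.
Qed.

End Hitting.

(** * Pathwise formula for the first arrival *)

Lemma stage0 (n : nat) (game : nat -> match_of n) : stage game 0 = n.
Proof. by rewrite stage_ancestors cardsT card_ord. Qed.

(** No new label is created, and only the loser changes label, so at most [f (loser g)]
    disappears. *)
Lemma stageS (n : nat) (game : nat -> match_of n) (k : nat) :
  (stage game k.+1 <= stage game k <= (stage game k.+1).+1)%N.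
Proof.
rewrite /stage /state !team_sizesE /= imset_play.
set f := teams game k; set g := game k; apply/andP; split.
  by apply/subset_leq_card/imsetS/finset.subsetT.
rewrite -[leqRHS]add1n -(cards1 (f (loser g))) (leq_trans _ (leq_card_setU _ _)) //.
apply/subset_leq_card/fintype.subsetP => _ /imsetP[i _ ->]; rewrite !inE.
have [->|il] := eqVneq i (loser g); first by rewrite eqxx.
apply/orP; right; apply/imset_f/imsetP; exists i; rewrite ?inE //.
by rewrite /copy (negbTE il).
Qed.

(** The series counts the times spent above [s]; steps down of size at most 1 cannot jump over
    [s]. *)
Lemma hitting_time_series (R : realType) (a : nat -> nat) (s : nat) :
  (s <= a 0)%N -> (forall k, a k.+1 <= a k <= (a k.+1).+1)%N ->
  ereal_inf [set (k%:R : R)%:E | k in [set k | a k = s]]%classic =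
  (\sum_(k <oo) ((s < a k)%N%:R : R)%:E)%E.
Proof.
move=> sa0 aS.
have term_ge0 k : (0 <= ((s < a k)%N%:R : R)%:E)%E by rewrite lee_fin ler0n.
have head m : (forall k, (k < m)%N -> (s < a k)%N) ->
    (\sum_(0 <= k < m) ((s < a k)%N%:R : R)%:E = (m%:R)%:E)%E.
  move=> sa; rewrite sumEFin (eq_big_nat _ _ (F2 := fun=> 1)).
    by rewrite sumr_const_nat subn0.
  by move=> k /andP[_ km]; rewrite sa.
have [reached|unreached] := pselect (exists k, (a k <= s)%N); last first.
  have sa k : (s < a k)%N by rewrite ltnNge; apply/negP => ak; apply: unreached; exists k.
  have -> : [set k | a k = s]%classic = set0.
    by rewrite -subset0 => k /= ak; have := sa k; rewrite ak ltnn.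
  rewrite image_set0 ereal_inf0; apply/esym/eq_infty => r.
  (* When [s] is never reached all terms are 1, so a partial sum longer than [r] shows that the
     series is infinite too. *)
  rewrite (@nneseries_split _ _ 0 (Num.trunc `|r|).+1) // add0n head //.
  apply: (@le_trans _ _ ((Num.trunc `|r|).+1%:R)%:E).
    by rewrite lee_fin (le_trans (ler_norm _)) // ltW // truncnS_gt.
  by rewrite leeDl // nneseries_ge0.
case: (ex_minnP reached) => m am m_min.
have below k : (k < m)%N -> (s < a k)%N.
  by rewrite !ltnNge; apply: contra => /m_min.
have after k : (m <= k)%N -> (a k <= s)%N.
  move=> /subnK <-; elim: (k - m)%N => // j; apply: leq_trans.
  by case/andP: (aS (j + m)%N).
(* At the least [m] with [a m <= s], either [m = 0] and [s <= a 0], or the previous value exceeds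
   [s] and drops by at most 1. *)
have ams : a m = s.
  apply/eqP; rewrite eqn_leq am /=; case: m below {am m_min after} => // m below.
  by rewrite -ltnS (leq_trans (below m _)) //; case/andP: (aS m).
rewrite (@nneseries_split _ _ 0 m) // add0n head // eseries0 ?adde0; last first.
  by move=> k mk _; rewrite ltnNge after.
apply/le_anti/andP; split.
  by apply: ereal_inf_lbound; exists m.
apply: le_ereal_inf_tmp => _ [k /= ak <-]; rewrite lee_fin ler_nat m_min //.
by rewrite ak.
Qed.

Lemma first_arrivalE (R : realType) (n s : nat) (game : nat -> match_of n) :
  (s <= n)%N ->
  first_arrival R game s = (\sum_(k <oo) ((s < stage game k)%N%:R)%:E)%E.
Proof.
by move=> sn; apply: hitting_time_series; [rewrite stage0 | exact: stageS].
Qed.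

(** * Law of the first [k] matches and expected first arrival *)

Section Law.
Import numFieldNormedType.Exports.
Local Open Scope classical_set_scope.
Variables (R : realType) (d : measure_display) (T : measurableType d).
Variables (P : probability T R) (n : nat) (X : nat -> T -> match_of n).
Hypotheses (n2 : (2 <= n)%N) (mX : forall k, measurable_match (X k)).
Hypotheses (uX : forall k, uniform_match P (X k)) (iX : independent_matches P X).

(* Taking [g] itself as the default of [nth] makes [nth g u i = g] say that [g]
   is the [i]-th entry of [u], without assuming [match_of n] inhabited. *)
Lemma cylinderE (k : nat) (u : k.-tuple (match_of n)) :
  [set w | mkseq (X^~ w) k = u] =
  \bigcap_(i in [set` iota 0 k]) (X i @^-1` [set g | nth g u i = g]).
Proof.
apply/seteqP; split=> [w /= uE i|w wu].
  by rewrite /= mem_iota -uE => ik; rewrite nth_mkseq.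
apply: (@eq_from_nth _ (X 0 w)); rewrite size_mkseq ?size_tuple // => i ik.
rewrite nth_mkseq //; have /= := wu i; rewrite mem_iota => /(_ ik) <-.
by apply: set_nth_default; rewrite size_tuple.
Qed.

Lemma measurable_cylinder (k : nat) (u : k.-tuple (match_of n)) :
  measurable [set w | mkseq (X^~ w) k = u].
Proof.
rewrite cylinderE; apply: fin_bigcap_measurable => // i _; exact: mX.
Qed.

Lemma prob_cylinder (k : nat) (u : k.-tuple (match_of n)) :
  P [set w | mkseq (X^~ w) k = u] = ((#|match_of n|%:R ^+ k)^-1)%:E.
Proof.
rewrite cylinderE iX ?iota_uniq // -exprVn.
rewrite (eq_big_seq (fun=> (#|match_of n|%:R^-1)%:E)); last first.
  move=> i; rewrite mem_iota /= => ik; rewrite -(uX i (tnth u (Ordinal ik))).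
  by congr (P (_ @^-1` _)); apply/seteqP; split=> g /=; rewrite (tnth_nth g).
by rewrite prodEFin big_const_seq count_predT size_iota iter_mulr_1.
Qed.

(** A finite disjoint union of cylinders, which reduces probabilities to counting tuples. *)
Lemma event_cylinders (B : pred (seq (match_of n))) (k : nat) :
  [set w | B (mkseq (X^~ w) k)] =
  \bigcup_(u in [set` [seq u : k.-tuple (match_of n) <-
                         enum {: k.-tuple (match_of n)} | B u]])
    [set w | mkseq (X^~ w) k = u].
Proof.
apply/seteqP; split=> [w Bw|w [u]] /=; last by rewrite mem_filter => /andP[Bu _] ->.
exists [tuple of mkseq (X^~ w) k] => //=.
by rewrite mem_filter mem_enum andbT.
Qed.

Lemma measurable_event (B : pred (seq (match_of n))) (k : nat) :
  measurable [set w | B (mkseq (X^~ w) k)].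
Proof.
rewrite event_cylinders; apply: fin_bigcup_measurable => // u _.
exact: measurable_cylinder.
Qed.

Lemma prob_event (B : pred (seq (match_of n))) (k : nat) :
  P [set w | B (mkseq (X^~ w) k)] =
  ((\sum_(u : k.-tuple (match_of n)) (B u)%:R) / #|match_of n|%:R ^+ k)%:E.
Proof.
rewrite event_cylinders measure_fin_bigcup //; last 2 first.
- by move=> u v _ _ [w [/= uw vw]]; apply: val_inj; rewrite /= -uw -vw.
- by move=> u _; exact: measurable_cylinder.
rewrite -fsbig_seq; last exact/filter_uniq/enum_uniq.
rewrite big_filter (eq_bigr _ (fun u _ => prob_cylinder _ u)).
rewrite sumEFin big_enum_cond /= big_mkcond mulr_suml; congr EFin.
by apply: eq_bigr => u _; case: (B u); rewrite ?mul1r ?mul0r.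
Qed.

Variable s : nat.
Hypotheses (s0 : (0 < s)%N) (sn : (s <= n)%N).

Let late (k : nat) : set T := [set w | (s < stage (X^~ w) k)%N].

Let lateE (k : nat) : late k = [set w | (s < #|ancestors (mkseq (X^~ w) k)|)%N].
Proof. by apply/seteqP; split=> w; rewrite /late /= stage_ancestors. Qed.

Let measurable_late (k : nat) : measurable (late k).
Proof. by rewrite lateE; exact: (measurable_event (fun u => s < #|ancestors u|)%N). Qed.

Let prob_late (k : nat) : P (late k) = (above R n s k)%:E.
Proof. by rewrite lateE; exact: (prob_event (fun u => s < #|ancestors u|)%N). Qed.

Let first_arrival_late :
  (fun w => first_arrival R (X^~ w) s) =
  (fun w => \sum_(k <oo) (\1_(late k) w)%:E)%E.
Proof.
apply/funext => w; rewrite first_arrivalE //; apply: eq_eseriesr => k _.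
by rewrite indicE /late mem_setE.
Qed.

Lemma first_arrival_ge0 (w : T) : (0 <= first_arrival R (X^~ w) s)%E.
Proof. by rewrite first_arrivalE // nneseries_ge0 // => k _ _; rewrite lee_fin. Qed.

Lemma measurable_first_arrival :
  measurable_fun [set: T] (fun w => first_arrival R (X^~ w) s).
Proof.
rewrite first_arrival_late; apply: ge0_emeasurable_sum => k *.
  by rewrite lee_fin.
by apply/measurable_EFinP; exact: measurable_indic.
Qed.

(** Monotone convergence exchanges integral and series, leaving the fixed-time probabilities
    [above]. *)
Lemma expected_first_arrival :
  (\int[P]_w first_arrival R (X^~ w) s = (hitting R n s n)%:E)%E.
Proof.
rewrite first_arrival_late integral_nneseries //; last first.
- by move=> k; apply/measurable_EFinP; exact: measurable_indic.
transitivity (\sum_(k <oo) (above R n s k)%:E)%E.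
  by apply: eq_eseriesr => k _; rewrite integral_indic // setIT; exact: prob_late.
apply/cvg_lim => //.
under eq_fun do rewrite sumEFin.
by apply: cvg_EFin; [near=> k | exact: cvg_series_above].
Unshelve. all: by end_near.
Qed.

Lemma integrable_first_arrival :
  P.-integrable setT (fun w => first_arrival R (X^~ w) s).
Proof.
apply/integrableP; split; first exact: measurable_first_arrival.
under eq_integral do rewrite gee0_abs ?first_arrival_ge0 //.
by rewrite expected_first_arrival ltry.
Qed.

End Law.

(** * Difference of two expected arrival times *)

Theorem theorem7 (R : realType) (d : measure_display) (T : measurableType d)
    (P : probability T R) (n t : nat) (X : nat -> T -> match_of n)
    (hn : (2 <= n)%N) (ht2 : (2 <= t)%N) (htn : (t <= n)%N)
    (hmeas : forall k : nat, measurable_match (X k))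
    (hunif : forall k : nat, uniform_match P (X k))
    (hindep : independent_matches P X) :
  expected_passage P X t t.-1
    = ((n%:R * (n%:R - 1)) / (t%:R * (t%:R - 1)))%:E
  /\ (n%:R * (n%:R - 1)) / (t%:R * (t%:R - 1)) =
     'C(n, 2)%:R / 'C(t, 2)%:R :> R.
Proof.
have natr_pred m : (0 < m)%N -> m.-1%:R = m%:R - 1 :> R.
  by move=> m0; rewrite -subn1 natrB.
have bin2R m : (0 < m)%N -> 'C(m, 2)%:R = m%:R * (m%:R - 1) / 2%:R :> R.
  move=> m0; rewrite -natr_pred // -natrM.
  by have := mul_bin_diag m 1; rewrite bin1 => ->; rewrite natrM; field.
have t0 : t%:R != 0 :> R by rewrite pnatr_eq0; lia.
have t1 : t%:R - 1 != 0 :> R by rewrite -natr_pred ?pnatr_eq0; lia.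
split; last by rewrite !bin2R; [field; rewrite t0 t1 | lia..].
have t1_gt0 : (0 < t.-1)%N by lia.
have t1_len : (t.-1 <= n)%N by lia.
have t_gt0 : (0 < t)%N by lia.
rewrite /expected_passage integralB //; [|exact: integrable_first_arrival..].
rewrite !expected_first_arrival // -EFinB; congr EFin.
(* The terms in [1/n] cancel, leaving [n (n - 1) (1/(t - 1) - 1/t)]. *)
rewrite /hitting card_match !(maxn_idPl _) // natrM !natr_pred //; last by lia.
have n0 : n%:R != 0 :> R by rewrite pnatr_eq0; lia.
by field; rewrite t0 t1 n0.
Qed.
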